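(* Let $S:\mathbb{R}^n\times\mathbb{R}^m\to\mathbb{R}$ be convex-concave and continuously differentiable, with at least one saddle point. Suppose that $S$ has an observable certificate. Then the saddle flow dynamics $$\dot x=-\nabla_x S(x,y),\qquad \dot y=+\nabla_y S(x,y)$$ globally asymptotically converge to some saddle point $(x_\star,y_\star)$ of $S$; that is, every trajectory $(x(t),y(t))$, from an arbitrary initial point in $\mathbb{R}^n\times\mathbb{R}^m$, converges as $t\to\infty$ to some saddle point of $S$ (possibly depending on the trajectory).
   Context: $S$ is convex-concave if $S(\cdot,y)$ is convex for every $y$ and $S(x,\cdot)$ is concave for every $x$. A saddle point of $S$ is a point $(x_\star,y_\star)$ with $S(x_\star,y)\le S(x_\star,y_\star)\le S(x,y_\star)$ for all $x\in\mathbb{R}^n$, $y\in\mathbb{R}^m$. Observable certificate: a function $h:\mathbb{R}^n\times\mathbb{R}^m\to\mathbb{R}_{\ge 0}^2$ is an observable certificate of $S$ if (i) there exists a saddle point $(x_\star,y_\star)$ of $S$ such that, for all $(x,y)$, componentwise, $$\begin{bmatrix} S(x_\star,y_\star)-S(x_\star,y)\\ S(x,y_\star)-S(x_\star,y_\star)\end{bmatrix}\ge h(x,y)\ge 0,$$ and (ii) for any trajectory $(x(t),y(t))$ of the saddle flow dynamics $\dot x=-\nabla_x S(x,y)$, $\dot y=\nabla_y S(x,y)$ satisfying $h(x(t),y(t))\equiv 0$, one has $\dot x\equiv 0$ and $\dot y\equiv 0$. *)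

(* Defs.v *)
From HB Require Import structures.
From mathcomp Require Export all_boot all_order all_algebra.
From mathcomp Require Export all_classical all_reals all_analysis.
Export Order.TTheory GRing.Theory Num.Theory.
Export numFieldNormedType.Exports.

Set Implicit Arguments.
Unset Strict Implicit.
Unset Printing Implicit Defensive.

Local Open Scope classical_set_scope.
Local Open Scope ring_scope.

Definition convex_concave (R : realType) (n m : nat)
    (S : 'rV[R]_n -> 'rV[R]_m -> R) : Prop :=
  (forall y, @convex_function R 'rV[R]_n setT (fun x => S x y)) /\
  (forall x, @convex_function R 'rV[R]_m setT (fun y => - S x y)).

Definition saddle_point (R : realType) (n m : nat)
    (S : 'rV[R]_n -> 'rV[R]_m -> R) (xs : 'rV[R]_n) (ys : 'rV[R]_m) : Prop :=
  forall x y, S xs y <= S xs ys <= S x ys.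

(* Fréchet differentiability everywhere, with [z |-> 'd f z] continuous for the
   operator norm. *)
Definition continuously_differentiable (R : realType) (V W : normedModType R)
    (f : V -> W) : Prop :=
  (forall z, differentiable f z) /\
  (forall z e, 0 < e ->
    \forall z' \near z, forall v, `|'d f z' v - 'd f z v| <= e * `|v|).

Definition gradient (R : realType) (n : nat) (f : 'rV[R]_n -> R)
    (x : 'rV[R]_n) : 'rV[R]_n :=
  \row_i 'D_(delta_mx 0 i) f x.

(* [x] is only looked at on [0, +oo[: the derivative is two-sided for [0 < t]
   and one-sided, from the right, for [t = 0]. *)
Definition has_velocity (R : realType) (V : normedModType R)
    (x : R -> V) (t : R) (v : V) : Prop :=
  (s - t)^-1 *: (x s - x t) @[s --> within `[0, +oo[ t^'] --> v.

Definition saddle_flow_trajectory (R : realType) (n m : nat)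
    (S : 'rV[R]_n -> 'rV[R]_m -> R)
    (x : R -> 'rV[R]_n) (y : R -> 'rV[R]_m) : Prop :=
  forall t, 0 <= t ->
    has_velocity x t (- gradient (fun u => S u (y t)) (x t)) /\
    has_velocity y t (gradient (fun w => S (x t) w) (y t)).

Definition observable_certificate (R : realType) (n m : nat)
    (S : 'rV[R]_n -> 'rV[R]_m -> R)
    (h : 'rV[R]_n -> 'rV[R]_m -> R * R) : Prop :=
  (exists xs ys, saddle_point S xs ys /\
    forall x y,
      0 <= (h x y).1 <= S xs ys - S xs y /\
      0 <= (h x y).2 <= S x ys - S xs ys) /\
  (forall x y, saddle_flow_trajectory S x y ->
    (forall t, 0 <= t -> h (x t) (y t) = (0, 0)) ->
    forall t, 0 <= t -> has_velocity x t 0 /\ has_velocity y t 0).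

(* Main.v *)
Require Import Defs.
From mathcomp Require Import ring lra.

Local Open Scope classical_set_scope.
Local Open Scope ring_scope.

Set Implicit Arguments.
Unset Strict Implicit.
Unset Printing Implicit Defensive.

(** Put [F (x, y) = (- grad_x S, grad_y S)].  Convexity in [x] and concavity in
    [y], both linearized at [(x, y)], give
    [<F (x, y), (x, y) - (a, b)> <= S a y - S x b]
    for all [(a, b)].  Adding two instances shows that [- F] is monotone, so any
    two trajectories get closer in Euclidean distance; a saddle point [e]
    satisfies [<F u, u - e> <= 0], so [|z - e|] decreases along a trajectory
    [z], which is thus bounded; and every zero of [F] is a saddle point.

    Let [z (tau n) --> p] with [tau n --> +oo].  As trajectories get closer, the
    shifted trajectories [z (tau n + t)] form a Cauchy sequence uniformly in
    [t], and their limit [w] is a trajectory from [p]: no existence theorem for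
    differential equations is needed.  The distance from [w] to [e] is constant,
    so [<F w, w - e>], and with it the certificate, vanishes along [w].
    Observability makes [w] stationary, hence [F p = 0], and comparing [z] with
    the constant trajectory [p] yields [z --> p]. *)

(** * Calculus of velocities on the half-line, one-sided at time [0] *)

Section velocity.
Context {R : realType}.
Implicit Types (V : normedModType R) (a b t : R).

(** Clearing the denominator makes the case [s = t] trivial, so the punctured neighbourhood becomes
    a full one. *)
Lemma has_velocityP V (x : R -> V) t v :
  has_velocity x t v <-> forall e, 0 < e ->
    \forall s \near t, 0 <= s -> `|x s - x t - (s - t) *: v| <= e * `|s - t|.
Proof.
have quotE s : s != t ->
    v - (s - t)^-1 *: (x s - x t) =
    - ((s - t)^-1 *: (x s - x t - (s - t) *: v)).
  move=> st; rewrite [in RHS]scalerBr scalerA mulVf ?subr_eq0// scale1r.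
  by rewrite opprB.
split.
  move=> /cvgrPdist_le xv e e0; have := xv e e0.
  move=> [r /= r0 tr]; exists r => //= s str s0.
  have [->|st] := eqVneq s t.
    by rewrite !subrr scale0r subr0 !normr0 mulr0.
  have := tr s str st; rewrite in_itv/= andbT => /(_ s0).
  rewrite quotE// normrN normrZ normfV ler_pdivrMl ?normr_gt0 ?subr_eq0//.
  by rewrite mulrC.
move=> xv; apply/cvgrPdist_le => e e0; have [r /= r0 tr] := xv e e0.
exists r => //= s str st; rewrite in_itv/= andbT => s0.
rewrite quotE// normrN normrZ normfV ler_pdivrMl ?normr_gt0 ?subr_eq0//.
by rewrite mulrC tr.
Qed.

(** For [0 <= t] the points [t + r / 2] show that the punctured half-line filter at [t] is proper,
    so limits along it are unique. *)
Lemma has_velocity_unique V (x : R -> V) t v w : 0 <= t ->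
  has_velocity x t v -> has_velocity x t w -> v = w.
Proof.
move=> t0; suff FF : ProperFilter (within `[0, +oo[ t^') by exact: cvg_unique.
apply: Build_ProperFilter_ex => A [r /= r0 tA].
exists (t + r / 2); apply: tA.
- by rewrite /= opprD addrA subrr sub0r normrN gtr0_norm; lra.
- by apply/eqP; lra.
- by rewrite /= in_itv/= andbT; lra.
Qed.

Lemma has_velocity_cvg V (x : R -> V) t v :
  has_velocity x t v -> x s @[s --> within `[0, +oo[ t^'] --> x t.
Proof.
move=> xv.
have -> : x t = (t - t) *: v + x t by rewrite subrr scale0r add0r.
apply: (@cvg_trans _ ((s - t) *: ((s - t)^-1 *: (x s - x t)) + x t
    @[s --> within `[0, +oo[ t^'])).
  apply: near_eq_cvg; exists 1 => //= s _ st _.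
  by rewrite scalerA mulfV ?subr_eq0// scale1r subrK.
apply: cvgD; last exact: cvg_cst.
apply: cvgZ => //; apply: cvgB; last exact: cvg_cst.
move=> A [r /= r0 tA]; exists r => //= s str _ _; exact: tA.
Qed.

Lemma has_velocity_at_right V (x : R -> V) t v : 0 <= t ->
  has_velocity x t v -> x s @[s --> t^'+] --> x t.
Proof.
move=> t0 /has_velocity_cvg xt; apply: cvg_trans xt.
apply: cvg_app => A [r /= r0 tA]; exists r => //= s str ts; apply: tA => //.
  by rewrite gt_eqF.
by rewrite /= in_itv/= andbT; lra.
Qed.

Lemma has_velocity_continuous V (x : R -> V) t v : 0 < t ->
  has_velocity x t v -> {for t, continuous x}.
Proof.
move=> t0 /has_velocity_cvg xt; apply/continuous_withinNx.
apply: cvg_trans xt.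
apply: cvg_app => A [r /= r0 tA].
(* A radius of at most [t] keeps [s] positive, so the restriction to the half-line is void. *)
exists (Num.min r t); first by rewrite /= lt_min r0.
move=> s /=; rewrite lt_min => /andP[str stt] st; apply: tA => //.
rewrite /= in_itv/= andbT; move: stt; rewrite ltr_norml; lra.
Qed.

Lemma has_velocity_is_derive V (x : R -> V) t v : 0 < t ->
  has_velocity x t v -> is_derive t 1 x v.
Proof.
move=> t0 xv.
suff xv' : h^-1 *: (x (h *: 1 + t) - x t) @[h --> 0^'] --> v.
  by split; [apply/cvg_ex; exists v | exact: cvg_lim].
apply/cvgrPdist_le => e e0; move/cvgrPdist_le : xv => /(_ e e0)[r /= r0 tr].
exists (Num.min r t); first by rewrite /= lt_min r0.
move=> h /=; rewrite lt_min sub0r normrN => /andP[hr ht] h0.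
have := tr (h + t); rewrite addrK [h *: 1](mulr1 h); apply.
- by rewrite /= opprD addrCA subrr addr0 normrN.
- by rewrite -subr_eq0 addrK.
- rewrite /= in_itv/= andbT; move: ht; rewrite ltr_norml; lra.
Qed.

(** The one-sided velocity at [a = 0] still gives right continuity, which is all that the classical
    theorem asks at this endpoint. *)
Lemma velocity_MVT (f df : R -> R) a b : 0 <= a -> a < b ->
  (forall t, a <= t <= b -> has_velocity f t (df t)) ->
  exists2 c, a <= c <= b & f b - f a = df c * (b - a).
Proof.
move=> a0 ab fv.
have [||c] := @MVT R f df a b ab.
- move=> t; rewrite in_itv/= => /andP[at_ tb].
  by apply: (has_velocity_is_derive _ (fv t _)); [lra | rewrite !ltW].
- apply/(continuous_within_itvP _ ab); split.
  + move=> t; rewrite in_itv/= => /andP[at_ tb].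
    by apply: (has_velocity_continuous _ (fv t _)); [lra | rewrite !ltW].
  + by apply: (has_velocity_at_right _ (fv a _)) => //; rewrite lexx ltW.
  + apply: cvg_at_left_filter.
    by apply: (has_velocity_continuous _ (fv b _)); [lra | rewrite lexx ltW].
by rewrite in_itv/= => /andP[ac cb] ->; exists c => //; rewrite !ltW.
Qed.

Lemma has_velocity_cst V (c : V) t : has_velocity (cst c) t 0.
Proof.
apply/has_velocityP => e e0; near=> s => _.
by rewrite subrr scaler0 subrr normr0 mulr_ge0 ?(ltW e0).
Unshelve. all: by end_near. Qed.

Lemma has_velocityB V (x y : R -> V) t v w :
  has_velocity x t v -> has_velocity y t w ->
  has_velocity (fun s => x s - y s) t (v - w).
Proof.
move=> xv yw; rewrite /has_velocity.
under eq_fun do rewrite opprD addrACA -opprD scalerBr.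
exact: cvgB.
Qed.

Lemma has_velocity_sum V (I : finType) (x : I -> R -> V) (v : I -> V) t :
  (forall i, has_velocity (x i) t (v i)) ->
  has_velocity (fun s => \sum_i x i s) t (\sum_i v i).
Proof.
move=> xv; rewrite /has_velocity.
under eq_fun do rewrite -sumrB scaler_sumr.
by apply: cvg_big => [|i _]; [exact: add_continuous | exact: xv].
Qed.

Lemma has_velocityM (f g : R -> R) t df dg :
  has_velocity f t df -> has_velocity g t dg ->
  has_velocity (fun s => f s * g s) t (f t * dg + g t * df).
Proof.
move=> fd gd; rewrite /has_velocity.
under eq_fun => s.
  rewrite (_ : _ *: _ = f s * ((s - t)^-1 * (g s - g t)) +
    g t * ((s - t)^-1 * (f s - f t))); last first.
    by rewrite [LHS]/GRing.scale/=; ring.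
  over.
apply: cvgD; last by apply: cvgMr.
by apply: cvgM => //; exact: has_velocity_cvg fd.
Qed.

Lemma has_velocity_shift V (x : R -> V) a t v : 0 <= a ->
  has_velocity x (a + t) v -> has_velocity (fun s => x (a + s)) t v.
Proof.
move=> a0 /has_velocityP xv; apply/has_velocityP => e /xv[r /= r0 tr].
exists r => //= s str s0.
have -> : s - t = (a + s) - (a + t) by ring.
apply: tr; last lra.
by rewrite /= opprD addrACA subrr add0r.
Qed.

Lemma has_velocity_near V (x : R -> V) t v (e : R) : 0 < e ->
  has_velocity x t v -> \forall s \near t, 0 <= s -> `|x s - x t| <= e.
Proof.
move=> e0 /has_velocity_cvg/cvgrPdist_le/(_ e e0)[r /= r0 tr].
exists r => //= s str s0.
have [->|st] := eqVneq s t; first by rewrite subrr normr0 ltW.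
by rewrite distrC tr//= in_itv/= s0.
Qed.

Lemma velocity_MVT_dist (f df : R -> R) (s t : R) : 0 <= s -> 0 <= t ->
  (forall r, 0 <= r -> has_velocity f r (df r)) ->
  exists c, [/\ 0 <= c, `|c - t| <= `|s - t| & f s - f t = df c * (s - t)].
Proof.
move=> s0 t0 fv; have [st|ts|->] := ltgtP s t; last first.
- by exists t; rewrite !subrr mulr0.
- have [|c /andP[tc cs] fE] := velocity_MVT t0 ts (df := df) (f := f).
    by move=> r /andP[tr _]; apply: fv; lra.
  exists c; split => //; first lra.
  by rewrite !ger0_norm; lra.
- have [|c /andP[sc ct] fE] := velocity_MVT s0 st (df := df) (f := f).
    by move=> r /andP[sr _]; apply: fv; lra.
  exists c; split => //; first lra.
    by rewrite !ler0_norm; lra.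
  by rewrite -[LHS]opprB fE; ring.
Qed.

Lemma velocity_le0_nincr (f df : R -> R) :
  (forall t, 0 <= t -> has_velocity f t (df t)) ->
  (forall t, 0 <= t -> df t <= 0) ->
  forall a b, 0 <= a -> a <= b -> f b <= f a.
Proof.
move=> fv df0 a b a0 ab.
have [c [c0 _ fE]] := velocity_MVT_dist (le_trans a0 ab) a0 fv.
by rewrite -subr_le0 fE mulr_le0_ge0 ?df0// subr_ge0.
Qed.

End velocity.

(** * The Euclidean dot product, compared with the sup norm of row vectors *)

Section dot_product.
Context {R : realType} {k : nat}.
Implicit Types u v w : 'rV[R]_k.

Definition dotp u v : R := \sum_i u 0 i * v 0 i.

Lemma dotpDl u v w : dotp (u + v) w = dotp u w + dotp v w.
Proof.
by rewrite /dotp -big_split; apply: eq_bigr => i _; rewrite !mxE mulrDl.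
Qed.

Lemma dotpNl u v : dotp (- u) v = - dotp u v.
Proof. by rewrite /dotp -sumrN; apply: eq_bigr => i _; rewrite !mxE mulNr. Qed.

Lemma dotpNr u v : dotp u (- v) = - dotp u v.
Proof. by rewrite /dotp -sumrN; apply: eq_bigr => i _; rewrite !mxE mulrN. Qed.

Lemma dotpBl u v w : dotp (u - v) w = dotp u w - dotp v w.
Proof. by rewrite dotpDl dotpNl. Qed.

Lemma dotpC u v : dotp u v = dotp v u.
Proof. by apply: eq_bigr => i _; rewrite mulrC. Qed.

Lemma dotp0l u : dotp 0 u = 0.
Proof. by rewrite -(subrr 0) dotpBl subrr. Qed.

Lemma mx_norm_leP u (c : R) : 0 <= c ->
  (`|u| <= c) <-> (forall i, `|u 0 i| <= c).
Proof.
move=> c0; rewrite [`|u|]mx_normrE; split.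
  by move=> /bigmax_leP[_ h] i; exact: (h (0, i)).
by move=> h; apply/bigmax_leP; split => // -[i j] _; rewrite ord1.
Qed.

Lemma ler_coord u i : `|u 0 i| <= `|u|.
Proof. by move: i; apply/mx_norm_leP. Qed.

Lemma ler_norm_dotp u (c : R) : 0 <= c -> dotp u u <= c ^+ 2 -> `|u| <= c.
Proof.
move=> c0 uc; apply/mx_norm_leP => // i.
rewrite -(@ler_pXn2r _ 2) ?nnegrE// (le_trans _ uc)// real_normK ?num_real//.
rewrite /dotp (bigD1 i)//= -expr2 lerDl sumr_ge0// => j _.
by rewrite -expr2 sqr_ge0.
Qed.

(** The crude constant [k.+1] avoids square roots and is positive even for [k = 0], so that it can
    serve as a divisor later. *)
Lemma dotp_le_norm u : dotp u u <= (k.+1%:R * `|u|) ^+ 2.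
Proof.
apply: (@le_trans _ _ (\sum_(i < k) `|u| ^+ 2)).
  apply: ler_sum => i _; rewrite -expr2 -[leLHS]real_normK ?num_real//.
  by rewrite ler_pXn2r ?nnegrE// ler_coord.
rewrite sumr_const card_ord -[leLHS]mulr_natl exprMn ler_wpM2r ?sqr_ge0//.
by rewrite -natrX ler_nat (leq_trans (leqnSn k))// leq_pmulr.
Qed.

Lemma has_velocity_coordP (z : R -> 'rV[R]_k) t v :
  has_velocity z t v <-> forall i, has_velocity (fun s => z s 0 i) t (v 0 i).
Proof.
split.
  move=> /has_velocityP zv i; apply/has_velocityP => e e0.
  apply: filterS (zv e e0) => s sz s0; apply: le_trans (sz s0).
  by apply: le_trans (ler_coord _ i); rewrite !mxE.
move=> zv; apply/has_velocityP => e e0.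
have : \forall s \near t, forall i, 0 <= s ->
    `|z s 0 i - z t 0 i - (s - t) * v 0 i| <= e * `|s - t|.
  apply: (@filter_forall R 'I_k _ (nbhs t) _) => i.
  by move/has_velocityP : (zv i) => /(_ e e0).
apply: filterS => s sz s0.
by apply/mx_norm_leP => [|i]; [rewrite mulr_ge0 ?(ltW e0) | rewrite !mxE sz].
Qed.

Lemma has_velocity_dotp (y z : R -> 'rV[R]_k) t v w :
  has_velocity y t v -> has_velocity z t w ->
  has_velocity (fun s => dotp (y s) (z s)) t (dotp (y t) w + dotp (z t) v).
Proof.
move=> /has_velocity_coordP yv /has_velocity_coordP zw.
rewrite /dotp -big_split; apply: has_velocity_sum => i /=.
exact: has_velocityM.
Qed.

Lemma cvg_dotp (T : Type) (G : set_system T) (FG : Filter G)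
    (f g : T -> 'rV[R]_k) u v :
  f x @[x --> G] --> u -> g x @[x --> G] --> v ->
  dotp (f x) (g x) @[x --> G] --> dotp u v.
Proof.
move=> fu gv; rewrite /dotp.
apply: cvg_big => [|i _]; first exact: add_continuous.
apply: cvgM.
- exact: (cvg_comp _ _ fu (@coord_continuous R 1 k 0 i u)).
- exact: (cvg_comp _ _ gv (@coord_continuous R 1 k 0 i v)).
Qed.

End dot_product.

(** * Trajectories of a continuous field whose opposite is monotone *)

Definition field_trajectory (R : realType) (V : normedModType R) (F : V -> V)
    (z : R -> V) : Prop :=
  forall t, 0 <= t -> has_velocity z t (F (z t)).

Section monotone_flow.
Context {R : realType} {k : nat} (F : 'rV[R]_k -> 'rV[R]_k).
Hypothesis F_continuous : continuous F.
Hypothesis F_monotone : forall u v, dotp (F u - F v) (u - v) <= 0.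
Implicit Types z w : R -> 'rV[R]_k.

Lemma field_trajectory_shift z (a : R) : 0 <= a ->
  field_trajectory F z -> field_trajectory F (fun t => z (a + t)).
Proof.
move=> a0 Fz t t0; apply: has_velocity_shift => //.
by apply: Fz; rewrite addr_ge0.
Qed.

(** The squared distance has velocity [2 <z - w, F z - v>]. The curve [w] need not be a trajectory,
    so a constant curve at a point that is not known to be a zero of [F] is allowed. *)
Lemma sqr_dist_nincr z w v : (forall t, 0 <= t -> has_velocity w t (v t)) ->
  field_trajectory F z ->
  (forall t, 0 <= t -> dotp (F (z t) - v t) (z t - w t) <= 0) ->
  forall a b, 0 <= a -> a <= b ->
  dotp (z b - w b) (z b - w b) <= dotp (z a - w a) (z a - w a).
Proof.
move=> wv Fz le0; apply: (@velocity_le0_nincr _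
    (fun t => dotp (z t - w t) (z t - w t))
    (fun t => dotp (z t - w t) (F (z t) - v t) +
              dotp (z t - w t) (F (z t) - v t))).
  by move=> t t0; apply: has_velocity_dotp; apply: has_velocityB; auto.
by move=> t t0; have := le0 t t0; rewrite dotpC; lra.
Qed.

Lemma trajectory_dist z w (t : R) : field_trajectory F z ->
  field_trajectory F w -> 0 <= t ->
  `|z t - w t| <= k.+1%:R * `|z 0 - w 0|.
Proof.
move=> Fz Fw t0; apply: ler_norm_dotp; first by rewrite mulr_ge0.
apply: le_trans (dotp_le_norm _).
by apply: (sqr_dist_nincr Fw Fz) => // s _; exact: F_monotone.
Qed.

(** Initial distances control all later ones, so for [n >= N] the curves [y n] stay near [w t] on a
    neighbourhood of [t] independent of [n]. There the mean value theorem bounds the error of each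
    increment of [y n], and the bound passes to the limit in [n]. *)
Lemma trajectory_limit (y : nat -> R -> 'rV[R]_k) w :
  (forall n, field_trajectory F (y n)) ->
  (forall t, 0 <= t -> y n t @[n --> \oo] --> w t) ->
  field_trajectory F w.
Proof.
move=> Fy yw t t0; apply/has_velocityP => e e0.
have [d /= d0 Fd] : exists2 d : R, 0 < d &
    forall u, `|u - w t| < d -> `|F u - F (w t)| <= e.
  have /cvgrPdist_le/(_ e e0)/nbhs_normP[d /= d0 wd] := @F_continuous (w t).
  by exists d => // u uw; rewrite distrC; apply: wd; rewrite /ball_ /= distrC.
have d4 : 0 < d / 4 by lra.
pose K : R := k.+1%:R.
have K0 : 0 < K by rewrite ltr0n.
(* Two initial errors [d / 8 / K], magnified by [K], give [d / 4]. With the variation of [y N] near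
   [t] and its distance to [w t] the total is at most [3 d / 4 < d]. *)
have [N _ yN] : \forall n \near \oo,
    `|y n 0 - w 0| <= d / 8 / K /\ `|y n t - w t| <= d / 4.
  have d8 : 0 < d / 8 / K by rewrite divr_gt0//; lra.
  have /cvgrPdist_le/(_ _ d8) y0 := yw 0 (lexx _).
  have /cvgrPdist_le/(_ _ d4) yt := yw t t0.
  by near=> n; split; rewrite distrC; near: n.
have {}yN n : (N <= n)%N ->
    `|y n 0 - w 0| <= d / 8 / K /\ `|y n t - w t| <= d / 4.
  exact: yN.
have [r /= r0 tr] := has_velocity_near d4 (Fy N t t0).
have near_wt n s : (N <= n)%N -> 0 <= s -> `|s - t| < r -> `|y n s - w t| < d.
  move=> Nn s0 st.
  have h1 : `|y n s - y N s| <= d / 4.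
    apply: le_trans (trajectory_dist (Fy n) (Fy N) s0) _.
    rewrite -/K mulrC -ler_pdivlMr//.
    have [[a _] [b _]] := (yN n Nn, yN N (leqnn _)).
    rewrite -(subrKA (w 0)) (le_trans (ler_normD _ _))//.
    rewrite [`|w 0 - _|]distrC (le_trans (lerD a b))//.
    by rewrite -mulrDl ler_pM2r ?invr_gt0//; lra.
  have h2 : `|y N s - y N t| <= d / 4 by apply: tr => //=; rewrite distrC.
  have [_ h3] := yN N (leqnn _).
  have -> : y n s - w t = (y n s - y N s) + (y N s - y N t) + (y N t - w t).
    by rewrite !subrKA.
  have := ler_normD (y n s - y N s + (y N s - y N t)) (y N t - w t).
  have := ler_normD (y n s - y N s) (y N s - y N t).
  lra.
exists r => //= s st s0; have {}st : `|s - t| < r by rewrite distrC.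
have yn : `|y n s - y n t - (s - t) *: F (w t)| @[n --> \oo] -->
    `|w s - w t - (s - t) *: F (w t)|.
  by apply: cvg_norm; apply: cvgB; [apply: cvgB; exact: yw | exact: cvg_cst].
apply: (cvgr_to_le yn); exists N => // n /= Nn.
apply/mx_norm_leP => [|i]; first by rewrite mulr_ge0// ltW.
(* The mean value theorem holds only for real functions, so [c] depends on the coordinate [i]; the
   sup norm recombines the coordinates. *)
have [c [c0 ct yE]] := velocity_MVT_dist s0 t0
  (fun r r0 => (has_velocity_coordP _ _ _).1 (Fy n r r0) i).
rewrite !mxE yE mulrC -mulrBr normrM mulrC ler_wpM2r//.
have := Fd (y n c) (near_wt n c Nn c0 (le_lt_trans ct st)).
by apply: le_trans; have := ler_coord (F (y n c) - F (w t)) i; rewrite !mxE.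
Unshelve. all: by end_near. Qed.

End monotone_flow.

(** * Behaviour of trajectories at infinity *)

(** The values of [z] lie in the compact box [[-M, M]^k], hence cluster at some [p]; [tau n] is
    picked beyond [n] with [z (tau n)] within [1 / (n + 1)] of [p]. *)
Lemma bounded_at_infty_cluster (R : realType) (k : nat)
    (z : R -> 'rV[R]_k) (M : R) :
  (forall t, 0 <= t -> `|z t| <= M) ->
  exists (p : 'rV[R]_k) (tau : nat -> R), [/\ forall n, 0 <= tau n,
    tau n @[n --> \oo] --> +oo & z (tau n) @[n --> \oo] --> p].
Proof.
move=> zM.
have [p [_ zp]] : [set v : 'rV[R]_k | forall i, `[- M, M]%classic (v ord0 i)]
    `&` cluster ((z @ pinfty_nbhs R)) !=set0.
  apply: (@rV_compact _ _ (fun=> `[- M, M]%classic)).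
    by move=> _; exact: segment_compact.
  exists 0; split=> // t /ltW t0 i; rewrite /= in_itv/= -ler_norml.
  exact: le_trans (ler_coord _ _) (zM t t0).
have /choice[tau tauP] (n : nat) :
    exists t, n%:R < t /\ `|p - z t| < n.+1%:R^-1.
  have zn : (z @ pinfty_nbhs R) [set z t | t in [set t | n%:R < t]].
    by exists n%:R; split=> // t nt; exists t.
  have pn : nbhs p [set q : 'rV[R]_k | `|p - q| < n.+1%:R^-1].
    apply/(@nbhs_normP R 'rV[R]_k p).
    by exists n.+1%:R^-1 => //=; rewrite invr_gt0.
  by have [_ [[t nt <-] zt]] := zp _ _ zn pn; exists t.
exists p, tau; split.
- by move=> n; rewrite ltW// (le_lt_trans _ (tauP n).1).
- apply/cvgryPge => A; near=> n; apply: ltW; apply: le_lt_trans (tauP n).1.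
  near: n; exact: nbhs_infty_ger.
- apply/cvgrPdist_le => e e0; near=> n.
  rewrite (le_trans (ltW (tauP n).2))// -[e]invrK lef_pV2 ?posrE ?invr_gt0//.
  rewrite (@le_trans _ _ n%:R)//; last by rewrite ler_nat.
  by near: n; exact: nbhs_infty_ger.
Unshelve. all: by end_near. Qed.

Section omega_limit.
Context {R : realType} {k : nat} (F : 'rV[R]_k -> 'rV[R]_k).
Hypothesis F_continuous : continuous F.
Hypothesis F_monotone : forall u v, dotp (F u - F v) (u - v) <= 0.

(** The curve [w] starts from a limit point of [z]. Stationarity of [w 0] is left as a premise of
    the last conclusion, because it will come from observability. *)
Lemma monotone_flow_limit (z : R -> 'rV[R]_k) (e : 'rV[R]_k) :
  field_trajectory F z -> (forall u, dotp (F u) (u - e) <= 0) ->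
  exists w, [/\ field_trajectory F w,
    forall t, 0 <= t -> dotp (F (w t)) (w t - e) = 0 &
    F (w 0) = 0 -> z t @[t --> +oo] --> w 0].
Proof.
move=> Fz Fe.
pose K : R := k.+1%:R.
have K0 : 0 < K by rewrite ltr0n.
have q_nincr a b : 0 <= a -> a <= b ->
    dotp (z b - e) (z b - e) <= dotp (z a - e) (z a - e).
  apply: (sqr_dist_nincr (w := cst e) (v := cst 0) _ Fz).
    by move=> t _; exact: has_velocity_cst.
  by move=> t _; rewrite subr0.
have z_bounded t : 0 <= t -> `|z t| <= `|e| + K * `|z 0 - e|.
  move=> t0; rewrite -(subrKC e (z t)) (le_trans (ler_normD _ _))// lerD2l.
  apply: ler_norm_dotp; first by rewrite mulr_ge0// ltW.
  exact: le_trans (q_nincr 0 t _ t0) (dotp_le_norm _).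
have [p [tau [tau0 tauy ztau]]] := bounded_at_infty_cluster z_bounded.
have Fztau n : field_trajectory F (fun t => z (tau n + t)).
  exact: field_trajectory_shift.
have ztau_cvg t : 0 <= t -> cvg (z (tau n + t) @[n --> \oo]).
  (* Both [z (tau n)] and [z (tau N)] are within [d / 2 / K / 2] of [p]; after any time [t] the
     shifted curves are at most [K] times as far apart as at the start, that is [d / 2]. *)
  move=> t0; apply/cauchy_cvgP/cauchy_exP => d d0.
  have d2 : 0 < d / 2 / K / 2 by rewrite !divr_gt0.
  have /cvgrPdist_le/(_ _ d2)[N _ zN] := ztau.
  exists (z (tau N + t)); exists N => // n /= Nn.
  rewrite -ball_normE /=.
  have := trajectory_dist F_monotone (Fztau N) (Fztau n) t0.
  move=> /le_lt_trans; apply; rewrite !addr0 -/K.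
  have a := zN N (leqnn _); have b := zN n Nn; rewrite /= in a b.
  rewrite mulrC -ltr_pdivlMr// (@le_lt_trans _ _ (d / 2 / K))//; last first.
    by rewrite ltr_pM2r ?invr_gt0//; lra.
  rewrite -(subrKA p) (le_trans (ler_normD _ _))//.
  by rewrite distrC (le_trans (lerD a b))// -splitr.
(* For [t < 0] this limit may be a default value; trajectories are only looked at for [0 <= t]. *)
pose w t := lim (z (tau n + t) @[n --> \oo]).
have ztauw t : 0 <= t -> z (tau n + t) @[n --> \oo] --> w t.
  by move=> t0; exact: ztau_cvg.
have Fw : field_trajectory F w by exact: (trajectory_limit _ _ Fztau).
have qw t : 0 <= t -> dotp (z (tau n + t) - e) (z (tau n + t) - e)
    @[n --> \oo] --> dotp (w t - e) (w t - e).
  by move=> t0; apply: cvg_dotp; (apply: cvgB; [exact: ztauw | exact: cvg_cst]).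
(* Along [z] the squared distance to [e] decreases to a limit, which is the
   squared distance from [e] to every point of [w]. *)
have q_le s t : 0 <= s -> 0 <= t ->
    dotp (w s - e) (w s - e) <= dotp (w t - e) (w t - e).
  move=> s0 t0; apply: (cvgr_to_ge (qw t t0)); near=> n.
  apply: (cvgr_to_le (qw s s0)); near=> m.
  apply: q_nincr; first by rewrite addr_ge0.
  rewrite (@le_trans _ _ (tau m))//; last by rewrite lerDl.
  by near: m; move/cvgryPge : tauy; exact.
have q_cst t : 0 <= t -> dotp (w t - e) (w t - e) = dotp (w 0 - e) (w 0 - e).
  by move=> t0; apply/eqP; rewrite eq_le !q_le.
exists w; split => // [t t0|Fw0].
  have we : has_velocity (fun s => w s - e) t (F (w t)).
    rewrite -[F _]subr0.
    by apply: has_velocityB; [exact: Fw | exact: has_velocity_cst].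
  (* The velocity of the constant squared distance is [0], and by the product rule it is also
     [2 <F w, w - e>]. *)
  have q0 : has_velocity (fun s => dotp (w s - e) (w s - e)) t 0.
    apply/has_velocityP => d d0; near=> s => s0.
    by rewrite !q_cst// subrr sub0r scaler0 normrN normr0 mulr_ge0// ltW.
  have := has_velocity_unique t0 q0 (has_velocity_dotp we we).
  by rewrite dotpC => /esym/eqP; rewrite -mulr2n mulrn_eq0/= => /eqP.
have Fp : field_trajectory F (cst (w 0)).
  by move=> t t0; rewrite /cst Fw0; exact: has_velocity_cst.
apply/cvgrPdist_le => d d0.
(* A single time [tau N] with [z] within [d / K] of [w 0] suffices: from then on the distance is at
   most [d]. *)
have dK : 0 < d / K by rewrite divr_gt0.
have /cvgrPdist_le/(_ _ dK)[N _ zN] := ztauw 0 (lexx _).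
near=> t; have tN : tau N <= t.
  by near: t; apply: nbhs_pinfty_ge; rewrite num_real.
have t0 : 0 <= t - tau N by rewrite subr_ge0.
have := trajectory_dist F_monotone Fp (Fztau N) t0.
rewrite subrKC => /le_trans; apply.
by rewrite mulrC -ler_pdivlMr//; exact: zN (leqnn _).
Unshelve. all: by end_near. Qed.

End omega_limit.

(** * Gradients: the convexity inequality and continuity of partial gradients *)

Section gradients.
Context {R : realType}.

Lemma derive_gradient (n : nat) (f : 'rV[R]_n -> R) x v :
  differentiable f x -> 'D_v f x = dotp (gradient f x) v.
Proof.
move=> fx; rewrite deriveE// [v in LHS]row_sum_delta linear_sum.
apply: eq_bigr => i _; rewrite linearZ /= mxE deriveE// mulrC.
by congr (_ * 'd f x (delta_mx _ _)); rewrite ?ord1.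
Qed.

(** By convexity the difference quotient along the segment from [x] to [y] is at most [f y - f x]
    for [0 < h <= 1]; then [h] tends to [0] from the right. *)
Lemma convex_gradient_le (n : nat) (f : 'rV[R]_n -> R) (x y : 'rV[R]_n) :
  @convex_function R 'rV[R]_n setT f -> differentiable f x ->
  dotp (gradient f x) (y - x) <= f y - f x.
Proof.
move=> f_convex fx; rewrite -derive_gradient//.
have /cvg_ex[l fl] := diff_derivable (v := y - x) fx.
have -> : 'D_(y - x) f x = l by apply: cvg_lim.
have {}fl : h^-1 *: (f (h *: (y - x) + x) - f x) @[h --> 0^'+] --> l.
  exact: cvg_dnbhs_at_right fl.
apply: (cvgr_to_le fl); near=> h.
have h0 : 0 < h by near: h; exact: nbhs_right_gt.
have h1 : h <= 1 by near: h; apply: nbhs_right_le.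
have fh : f (h *: y + (1 - h) *: x) <= h * f y + (1 - h) * f x.
  exact: (f_convex (Itv01 (ltW h0) h1) y x (in_setT _) (in_setT _)).
rewrite [leLHS]/GRing.scale/= ler_pdivrMl//.
rewrite [h *: _ + x](_ : _ = h *: y + (1 - h) *: x); last first.
  by rewrite scalerBr scalerBl scale1r -addrA; congr (_ + _); rewrite addrC.
lra.
Unshelve. all: by end_near. Qed.

Context {n m : nat} (S : 'rV[R]_n -> 'rV[R]_m -> R).
Hypothesis S_C1 : continuously_differentiable
  (fun z : 'rV[R]_n * 'rV[R]_m => S z.1 z.2).

Lemma differentiable_fst_arg x y : differentiable (fun u => S u y) x.
Proof.
apply: (@differentiable_comp _ _ _ _ (fun u : 'rV[R]_n => (u, y))
  (fun z : 'rV[R]_n * 'rV[R]_m => S z.1 z.2)); last exact: S_C1.1.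
by apply: differentiable_pair; [exact: ex_diff | exact: differentiable_cst].
Qed.

Lemma differentiable_snd_arg x y : differentiable (fun w => S x w) y.
Proof.
apply: (@differentiable_comp _ _ _ _ (fun w : 'rV[R]_m => (x, w))
  (fun z : 'rV[R]_n * 'rV[R]_m => S z.1 z.2)); last exact: S_C1.1.
by apply: differentiable_pair; [exact: differentiable_cst | exact: ex_diff].
Qed.

(** Written through the joint differential, partial gradients inherit its continuity in both
    variables. *)
Lemma gradient_fst_diff x y i : gradient (fun u => S u y) x 0 i =
  'd (fun z : 'rV[R]_n * 'rV[R]_m => S z.1 z.2) (x, y) (delta_mx 0 i, 0).
Proof.
rewrite mxE -deriveE; last exact: S_C1.1.
rewrite /derive; congr (lim (_ @ 0^')); apply/funext => h.
by rewrite /= scaler0 add0r.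
Qed.

Lemma gradient_snd_diff x y i : gradient (fun w => S x w) y 0 i =
  'd (fun z : 'rV[R]_n * 'rV[R]_m => S z.1 z.2) (x, y) (0, delta_mx 0 i).
Proof.
rewrite mxE -deriveE; last exact: S_C1.1.
rewrite /derive; congr (lim (_ @ 0^')); apply/funext => h.
by rewrite /= scaler0 add0r.
Qed.

Lemma continuous_diff_apply (v : 'rV[R]_n * 'rV[R]_m) : continuous
  (fun z => 'd (fun z : 'rV[R]_n * 'rV[R]_m => S z.1 z.2) z v).
Proof.
move=> z; apply/cvgrPdist_le => e e0.
(* The added [1] covers the case [v = 0]. *)
have ev : 0 < e / (`|v| + 1) by rewrite divr_gt0// ltr_wpDl.
have zv := S_C1.2 z _ ev.
near=> z'.
have zz' : forall u, `|'d (fun z : 'rV[R]_n * 'rV[R]_m => S z.1 z.2) z' u -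
    'd (fun z : 'rV[R]_n * 'rV[R]_m => S z.1 z.2) z u| <= e / (`|v| + 1) * `|u|.
  by near: z'.
rewrite distrC (le_trans (zz' v))//.
by rewrite mulrAC ler_pdivrMr ?ltr_wpDl// ler_wpM2l ?lerDl// ltW.
Unshelve. all: by end_near. Qed.

End gradients.

(** * The saddle flow as a single monotone flow *)

Section saddle_flow.
Context {R : realType} {n m : nat} (S : 'rV[R]_n -> 'rV[R]_m -> R).

(** Concatenating the two blocks into one row vector makes the results on a single field
    applicable. *)
Definition saddle_field (u : 'rV[R]_(n + m)) : 'rV[R]_(n + m) :=
  row_mx (- gradient (fun v => S v (rsubmx u)) (lsubmx u))
         (gradient (fun w => S (lsubmx u) w) (rsubmx u)).

Lemma dotp_row_mx (a c : 'rV[R]_n) (b d : 'rV[R]_m) :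
  dotp (row_mx a b) (row_mx c d) = dotp a c + dotp b d.
Proof.
rewrite /dotp big_split_ord /=; congr (_ + _); apply: eq_bigr => i _.
  by rewrite !row_mxEl.
by rewrite !row_mxEr.
Qed.

Lemma has_velocity_row_mx (x : R -> 'rV[R]_n) (y : R -> 'rV[R]_m) t v w :
  has_velocity (fun s => row_mx (x s) (y s)) t (row_mx v w) <->
  has_velocity x t v /\ has_velocity y t w.
Proof.
split.
  move=> /has_velocity_coordP xy; split; apply/has_velocity_coordP => i.
    have := xy (lshift m i); rewrite row_mxEl.
    by under eq_fun do rewrite row_mxEl.
  have := xy (rshift n i); rewrite row_mxEr.
  by under eq_fun do rewrite row_mxEr.
move=> [/has_velocity_coordP xv /has_velocity_coordP yw].
apply/has_velocity_coordP => i; case: (splitP i) => j ij.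
  have -> : i = lshift m j by exact: val_inj.
  by rewrite row_mxEl; under eq_fun do rewrite row_mxEl; exact: xv.
have -> : i = rshift n j by exact: val_inj.
by rewrite row_mxEr; under eq_fun do rewrite row_mxEr; exact: yw.
Qed.

Lemma saddle_flow_trajectoryP x y : saddle_flow_trajectory S x y <->
  field_trajectory saddle_field (fun t => row_mx (x t) (y t)).
Proof.
by split=> xy t t0; have := xy t t0;
  rewrite /saddle_field row_mxKl row_mxKr has_velocity_row_mx.
Qed.

Hypothesis S_C1 : continuously_differentiable
  (fun z : 'rV[R]_n * 'rV[R]_m => S z.1 z.2).

Lemma saddle_field_continuous : continuous saddle_field.
Proof.
have sub_continuous : continuous
    (fun u : 'rV[R]_(n + m) => (lsubmx u, rsubmx u)).
  move=> u; apply: differentiable_continuous.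
  apply: differentiable_pair; first exact: differentiable_lsubmx.
  exact: differentiable_rsubmx.
pose S' := fun z : 'rV[R]_n * 'rV[R]_m => S z.1 z.2.
have dS_continuous v : continuous
    (fun u : 'rV[R]_(n + m) => 'd S' (lsubmx u, rsubmx u) v).
  move=> u; exact: (cvg_comp _ _ (sub_continuous u)
    (continuous_diff_apply S_C1 (v := v) (x := _))).
have field_coord i : continuous (fun u => saddle_field u 0 i).
  case: (splitP i) => j ij.
    have -> : i = lshift m j by exact: val_inj.
    rewrite (_ : (fun u => _) =
        fun u => - 'd S' (lsubmx u, rsubmx u) (delta_mx 0 j, 0)).
      by move=> u; exact: (cvgN (@dS_continuous _ u)).
    by apply/funext => u; rewrite row_mxEl mxE gradient_fst_diff.
  have -> : i = rshift n j by exact: val_inj.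
  rewrite (_ : (fun u => _) =
      fun u => 'd S' (lsubmx u, rsubmx u) (0, delta_mx 0 j)).
    exact: dS_continuous.
  by apply/funext => u; rewrite row_mxEr gradient_snd_diff.
move=> u; apply/(cvgrPdist_le (FF := nbhs_filter u)) => e e0.
have : \forall v \near u, forall i,
    `|saddle_field u 0 i - saddle_field v 0 i| <= e.
  apply: (@filter_forall _ 'I_(n + m) _ (nbhs u) (nbhs_filter u)) => i.
  by have /cvgrPdist_le/(_ e e0) := @field_coord i u.
apply: filterS => v uv; apply/mx_norm_leP => [|i]; first exact: ltW.
by rewrite mxE [X in _ + X]mxE; exact: uv.
Qed.

Hypothesis S_cc : convex_concave S.

(** Sum of the gradient inequalities for the convex functions [S(., y)], from [x] to [a], and
    [- S(x, .)], from [y] to [b]; the terms [S x y] cancel. *)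
Lemma saddle_field_gap (x a : 'rV[R]_n) (y b : 'rV[R]_m) :
  dotp (saddle_field (row_mx x y)) (row_mx x y - row_mx a b) <= S a y - S x b.
Proof.
rewrite /saddle_field row_mxKl row_mxKr opp_row_mx add_row_mx dotp_row_mx.
have hx := convex_gradient_le a (S_cc.1 y) (differentiable_fst_arg S_C1 x y).
have Sxy := differentiable_snd_arg S_C1 x y.
have := convex_gradient_le b (S_cc.2 x) (differentiableN Sxy).
have -> : gradient (fun w => - S x w) y = - gradient (S x) y.
  by apply/rowP => i; rewrite !mxE deriveN//; exact: diff_derivable.
move: hx; rewrite !dotpNl -[x - a]opprB -[y - b]opprB !dotpNr.
lra.
Qed.

Lemma saddle_field_monotone (u v : 'rV[R]_(n + m)) :
  dotp (saddle_field u - saddle_field v) (u - v) <= 0.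
Proof.
rewrite dotpBl -[X in _ - dotp _ X]opprB dotpNr opprK.
have := saddle_field_gap (lsubmx u) (lsubmx v) (rsubmx u) (rsubmx v).
have := saddle_field_gap (lsubmx v) (lsubmx u) (rsubmx v) (rsubmx u).
rewrite !hsubmxK; lra.
Qed.

(** At a zero the gap inequality reads [0 <= S a y - S x b]; the choices [b = y] and [a = x] give
    the two saddle inequalities. *)
Lemma saddle_point_of_zero x y :
  saddle_field (row_mx x y) = 0 -> saddle_point S x y.
Proof.
move=> F0 a b; have hgap := saddle_field_gap x _ y _.
have := hgap a y; have := hgap x b; rewrite F0 !dotp0l !subr_ge0.
by move=> -> ->.
Qed.

End saddle_flow.

Theorem theorem1 (R : realType) (n m : nat)
    (S : 'rV[R]_n -> 'rV[R]_m -> R)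
    (S_convex_concave : convex_concave S)
    (S_C1 : continuously_differentiable
              (fun z : 'rV[R]_n * 'rV[R]_m => S z.1 z.2))
    (S_saddle : exists xs ys, saddle_point S xs ys)
    (S_certificate : exists h, observable_certificate S h) :
  forall (x : R -> 'rV[R]_n) (y : R -> 'rV[R]_m),
    saddle_flow_trajectory S x y ->
    exists xs ys, saddle_point S xs ys /\
      x t @[t --> +oo] --> xs /\ y t @[t --> +oo] --> ys.
Proof.
move=> x y xy.
have [h [[xs [ys [xys hS]]] h_observable]] := S_certificate.
have gap := saddle_field_gap S_C1 S_convex_concave.
have [u|w [Fw w_gap w_lim]] := monotone_flow_limit
    (saddle_field_continuous S_C1) (saddle_field_monotone S_C1 S_convex_concave)
    ((saddle_flow_trajectoryP S x y).1 xy) (e := row_mx xs ys).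
  rewrite -[u]hsubmxK; apply: le_trans (gap _ _ _ _) _.
  rewrite subr_le0; have /andP[a b] := xys (lsubmx u) (rsubmx u).
  exact: le_trans a b.
pose wx t := lsubmx (w t); pose wy t := rsubmx (w t).
have wE t : w t = row_mx (wx t) (wy t) by rewrite hsubmxK.
have wS : saddle_flow_trajectory S wx wy.
  by apply/saddle_flow_trajectoryP; under eq_fun do rewrite -wE.
have w_h t : 0 <= t -> h (wx t) (wy t) = (0, 0).
  (* The gap inequality gives [0 <= S xs (wy t) - S (wx t) ys], while the two nonnegative
     certificate entries sum to at most the opposite of the right side; both vanish. *)
  move=> t0; have := gap (wx t) xs (wy t) ys; rewrite -wE w_gap//.
  have [] := hS (wx t) (wy t); case: (h _ _) => h1 h2 /=.
  by move=> *; congr (_, _); lra.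
have F0 : saddle_field S (w 0) = 0.
  apply: (has_velocity_unique (lexx 0) (Fw 0 (lexx 0))).
  have [vx vy] := h_observable _ _ wS w_h 0 (lexx 0).
  rewrite -row_mx0; have -> : w = fun t => row_mx (wx t) (wy t) by apply/funext.
  exact/has_velocity_row_mx.
(* The limit is [w 0], which may differ from the saddle point [(xs, ys)] of the certificate. *)
exists (wx 0), (wy 0); split.
  by apply: (saddle_point_of_zero S_C1 S_convex_concave); rewrite -wE.
split.
  have -> : x = lsubmx \o (fun t => row_mx (x t) (y t)).
    by apply/funext => t; rewrite /= row_mxKl.
  exact: cvg_comp (w_lim F0)
    (differentiable_continuous (differentiable_lsubmx _)).
have -> : y = rsubmx \o (fun t => row_mx (x t) (y t)).
  by apply/funext => t; rewrite /= row_mxKr.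
exact: cvg_comp (w_lim F0)
  (differentiable_continuous (differentiable_rsubmx _)).
Qed.
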